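(* Let $f(a,b,c;z)={}_2F_1(a,b;c;z)$, $g=f^2$, $\theta=z\,\frac{d}{dz}$, and $$B_f=(f,\theta f),\qquad B_{\mathrm{sym}}=(f^2,f\theta f,(\theta f)^2),\qquad B_g=(g,\theta g,\theta^2g).$$ Assume that we work away from the rank-drop locus, so that for generic parameters the three entries of $B_{\mathrm{sym}}$ and of $B_g$ form bases of the rank-$3$ D-finite module generated by $g$. Then: (a) the basis-change matrix from $B_{\mathrm{sym}}$ to $B_g$ is $$\Phi(a,b,c;z)=\begin{pmatrix}1&0&\dfrac{2abz}{1-z}\\[2mm]0&2&\dfrac{2((a+b)z-c+1)}{1-z}\\[2mm]0&0&2\end{pmatrix},\qquad\det\Phi=4;$$ that is, $B_{\mathrm{sym}}\,\Phi(a,b,c;z)=B_g$; (b) for every parameter shift $u\in\mathbb{Z}^3$ for which the corresponding contiguous matrices are defined, the CMF generator of $g$ in basis $B_g$ is related to the Gauss-CMF generator of $f$ by $$M_u^{(g)}(a,b,c;z)=\Phi(a,b,c;z)^{-1}\,\operatorname{Sym}^2\bigl(M_u^{(f)}(a,b,c;z)\bigr)\,\sigma_u(\Phi)(a,b,c;z).$$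
   Context: For $u\in\mathbb{Z}^3$, $\sigma_u$ denotes the shift of parameters $(a,b,c)\mapsto(a,b,c)+u$, acting on functions and entrywise on vectors and matrices. A Conservative Matrix Field (CMF) of rank $r$ is a family of invertible $r\times r$ matrices of rational functions $M_v$, $v\in\mathbb{Z}^d$, with $M_{v+w}=M_v\,\sigma_v(M_w)$. The Gauss CMF has generators $M_u^{(f)}$ (matrices of rational functions in $a,b,c,z$) defined by $B_f\,M_u^{(f)}=\sigma_u(B_f)$, i.e. by the contiguous relations; likewise $M_u^{(g)}$ is defined by $B_g\,M_u^{(g)}=\sigma_u(B_g)$. The D-finite module generated by $g$ is taken over the field of rational functions in $z$ and the parameters; the rank-drop locus is where the entries of these triples cease to be linearly independent, i.e. the module has rank less than $3$. For a $2\times2$ matrix acting on a row basis $(u,v)$ by right multiplication, $$\operatorname{Sym}^2\begin{pmatrix}a&b\\c&d\end{pmatrix}=\begin{pmatrix}a^2&ab&b^2\\2ac&ad+bc&2bd\\c^2&cd&d^2\end{pmatrix},$$ the induced action on $(u^2,uv,v^2)$. *)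

(* Defs.v *)
From HB Require Import structures.
From mathcomp Require Import all_boot all_order all_algebra.
From mathcomp Require Import fraction complex.
From mathcomp Require Import all_classical all_reals all_analysis.
From mathcomp Require mpoly.
(* The notations of mpoly clash with those of mathcomp-analysis. *)
Import -(notations) mpoly.
Set Implicit Arguments.
Unset Strict Implicit.
Unset Printing Implicit Defensive.
Import Order.TTheory GRing.Theory Num.Theory.
Import numFieldNormedType.Exports.

Local Open Scope ring_scope.

(* R[i] as a numClosedFieldType, which is how it receives its topology. *)
Definition CC (R : realType) : numClosedFieldType := R[i].

(* T-valued functions of (a, b, c, z). *)
Definition pfun (R : realType) (T : Type) := CC R -> CC R -> CC R -> CC R -> T.

Definition poch (K : nzRingType) (x : K) (n : nat) : K :=
  \prod_(i < n) (x + i%:R).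

(* The sum of the Gauss series; it is only meaningful for |z| < 1 and c not in
   {0, -1, -2, ...}. *)
Definition hyp2F1 (R : realType) : pfun R (CC R) := fun a b c z =>
  limn (series (fun n : nat =>
    poch a n * poch b n / (poch c n * (n`!)%:R) * z ^+ n)).

(* theta = z d/dz, with d/dz the complex derivative. *)
Definition theta (R : realType) (h : pfun R (CC R)) : pfun R (CC R) :=
  fun a b c z => z * derive1 (h a b c) z.

Definition fshift (R : realType) (T : Type) (u : int * int * int)
    (h : pfun R T) : pfun R T :=
  fun a b c z => h (a + u.1.1%:~R) (b + u.1.2%:~R) (c + u.2%:~R) z.

Definition hypf (R : realType) : pfun R (CC R) := @hyp2F1 R.

Definition hypg (R : realType) : pfun R (CC R) :=
  fun a b c z => hypf a b c z ^+ 2.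

Definition Bf (R : realType) : pfun R 'rV[CC R]_2 := fun a b c z =>
  \row_(j < 2) [:: hypf a b c z; theta (@hypf R) a b c z]`_j.

Definition Bsym (R : realType) : pfun R 'rV[CC R]_3 := fun a b c z =>
  \row_(j < 3) [:: hypf a b c z ^+ 2;
                   hypf a b c z * theta (@hypf R) a b c z;
                   theta (@hypf R) a b c z ^+ 2]`_j.

Definition Bg (R : realType) : pfun R 'rV[CC R]_3 := fun a b c z =>
  \row_(j < 3) [:: hypg a b c z;
                   theta (@hypg R) a b c z;
                   theta (theta (@hypg R)) a b c z]`_j.

(* Rational functions over CC R; the variables 0, 1, 2, 3 stand for
   a, b, c, z. *)
Definition ratf (R : realType) : fieldType := {fraction mpoly 4 (CC R)}.

Definition ratX (R : realType) (i : 'I_4) : ratf R :=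
  tofrac (mpolyX (CC R) (mnm1 i)).

Definition point (R : realType) : pfun R ('I_4 -> CC R) :=
  fun a b c z i => [:: a; b; c; z]`_i.

(* Notation \d_ of fraction.v is taken over by the Dirac measure. *)
Definition numer (R : realType) (r : ratf R) : mpoly 4 (CC R) :=
  (frac (repr (r : {fraction mpoly 4 (CC R)}))).1.

Definition denom (R : realType) (r : ratf R) : mpoly 4 (CC R) :=
  (frac (repr (r : {fraction mpoly 4 (CC R)}))).2.

(* The value of the quotient of the chosen representatives of numerator and
   denominator: where this denominator vanishes the value is junk, so rateval
   may only be used up to generic_eq below. *)
Definition rateval (R : realType) (r : ratf R) : pfun R (CC R) :=
  fun a b c z => meval (point a b c z) (numer r)
                 / meval (point a b c z) (denom r).

Definition shift_subst (R : realType) (u : int * int * int) :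
    4.-tuple (mpoly 4 (CC R)) :=
  [tuple mpolyX (CC R) (mnm1 i) + ([:: u.1.1; u.1.2; u.2; 0 : int]`_i)%:~R
     | i < 4].

Definition ratshift (R : realType) (u : int * int * int) (r : ratf R) :
    ratf R :=
  tofrac (comp_mpoly (shift_subst R u) (numer r))
  / tofrac (comp_mpoly (shift_subst R u) (denom r)).

(* Equality as meromorphic functions of (a, b, c, z): equality off the zero set
   of some nonzero polynomial. Excluding every integer c makes the domain
   stable under the parameter shifts; what is excluded is nowhere dense. *)
Definition generic_eq (R : realType) (T : Type) (h1 h2 : pfun R T) : Prop :=
  exists2 q : mpoly 4 (CC R), q != 0 &
    forall a b c z : CC R,
      `|z| < 1 -> (forall k : int, c != k%:~R) ->
      meval (point a b c z) q != 0 ->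
      h1 a b c z = h2 a b c z.

Definition actmx (R : realType) (m n : nat) (B : pfun R 'rV[CC R]_m)
    (M : 'M[ratf R]_(m, n)) : pfun R 'rV[CC R]_n :=
  fun a b c z => B a b c z *m map_mx (fun r => rateval r a b c z) M.

(* Linear independence of the entries of B over the field of rational functions
   in z and the parameters. *)
Definition lin_indep (R : realType) (n : nat) (B : pfun R 'rV[CC R]_n) : Prop :=
  forall v : 'cV[ratf R]_n,
    generic_eq (actmx B v) (fun _ _ _ _ => 0) -> v = 0.

Definition is_basis_change (R : realType) (m n : nat)
    (B : pfun R 'rV[CC R]_m) (B' : pfun R 'rV[CC R]_n)
    (P : 'M[ratf R]_(m, n)) : Prop :=
  generic_eq (actmx B P) B'.

(* M is the generator M_u in the basis B: B M = sigma_u B. *)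
Definition is_generator (R : realType) (n : nat) (B : pfun R 'rV[CC R]_n)
    (u : int * int * int) (M : 'M[ratf R]_n) : Prop :=
  generic_eq (actmx B M) (fshift u B).

Definition mx3 (K : nzRingType) (rows : seq (seq K)) : 'M[K]_3 :=
  \matrix_(i < 3, j < 3) (nth [::] rows i)`_j.

Definition Sym2 (K : nzRingType) (M : 'M[K]_2) : 'M[K]_3 :=
  let a := M 0 0 in let b := M 0 1 in
  let c := M 1 0 in let d := M 1 1 in
  mx3 [:: [:: a ^+ 2; a * b; b ^+ 2];
          [:: 2 * a * c; a * d + b * c; 2 * b * d];
          [:: c ^+ 2; c * d; d ^+ 2]].

Definition Phi (K : fieldType) (a b c z : K) : 'M[K]_3 :=
  mx3 [:: [:: 1; 0; 2 * a * b * z / (1 - z)];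
          [:: 0; 2; 2 * ((a + b) * z - c + 1) / (1 - z)];
          [:: 0; 0; 2]].

Definition ratPhi (R : realType) : 'M[ratf R]_3 :=
  Phi (ratX R 0) (ratX R 1) (ratX R 2) (ratX R 3).

(* Main.v *)
Require Import Defs.
From HB Require Import structures.
From mathcomp Require Import all_boot all_order all_algebra.
From mathcomp Require Import fraction complex generic_quotient ring lra.
From mathcomp Require Import all_classical all_reals all_analysis.
From mathcomp Require mpoly.
Import -(notations) mpoly.
Set Implicit Arguments.
Unset Strict Implicit.
Unset Printing Implicit Defensive.
Import Order.TTheory GRing.Theory Num.Theory.
Import numFieldNormedType.Exports.
Local Open Scope classical_set_scope.
Local Open Scope ring_scope.

(** Since theta is a derivation, g = f^2 satisfies theta g = 2 f theta f and
    theta^2 g = 2 (theta f)^2 + 2 f theta^2 f. The hypergeometric equation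
      (1 - z) theta^2 f = ((a + b) z - c + 1) theta f + a b z f
    eliminates theta^2 f from the latter, and the coefficients of what remains
    are the columns of Phi ([Bsym_Phi]). The analytic content is thus that f is a
    power series which may be differentiated termwise twice in the unit disc
    ([disc_bounded_gauss], [is_derive_psum]), where theta multiplies the n-th
    coefficient by n, so that the equation reduces to the two-term recurrence of
    the Gauss coefficients ([gauss_ode]).

    The statements on matrices of rational functions are then formal. Away from
    the zero set of a nonzero polynomial, evaluation at a point is compatible
    with ring operations ([ev_add], [ev_mul]) and turns the substitution
    sigma_u into evaluation at the shifted point ([ev_shift]). Linear
    independence of B_sym makes a matrix M of rational functions unique once
    B_sym M is known generically ([lin_indep_inj]), which gives uniqueness of Phi.
    Taking symmetric squares in B_f M_f = sigma_u(B_f) yields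
    B_sym Sym2(M_f) = sigma_u(B_sym), since Sym2(M) describes the action of M on
    (u^2, u v, v^2) ([sym2_row_mul], [generator_sym]). Hence
      B_sym Phi M_g = B_g M_g   and
      B_sym Sym2(M_f) sigma_u(Phi) = sigma_u(B_sym Phi) = sigma_u(B_g),
    so M_g is a generator exactly when Phi M_g = Sym2(M_f) sigma_u(Phi)
    ([generator_change]), and Phi is invertible because its determinant is 4. *)

(** * Convergence of complex series *)

Section ComplexSeries.
Variable R : realType.
Local Notation C := (CC R).
Local Notation "x %:C" := (real_complex R x : C).
Implicit Types (u : C^nat) (x : R).

Lemma cvg_real_complex (v : R^nat) (l : R) :
  v @ \oo --> l -> ((v n)%:C @[n --> \oo] --> l%:C).
Proof.
move=> vl; apply/cvgrPdist_lt => e e0.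
have eE : e = (complex.Re e)%:C.
  by rewrite -[LHS](@RRe_real R) // realE ltW.
have re0 : 0 < complex.Re e by rewrite -ltcR -eE.
move/cvgrPdist_lt : vl => /(_ _ re0); apply: filterS => n.
rewrite -(rmorphB (real_complex R)) eE normc_def /= expr0n addr0 sqrtr_sqr.
by rewrite ltcR.
Qed.

Lemma cvg_real_series (v : R^nat) (M : R) :
  (forall n, \sum_(k < n) `|v k| <= M) -> cvgn (series v).
Proof.
move=> vM; apply: normed_cvg; apply: nondecreasing_is_cvgn.
  exact: (@nondecreasing_series _ (fun k => `|v k|) xpredT).
exists M => _ [n _ <-].
by have := vM n; rewrite -(big_mkord xpredT (fun k => `|v k|)).
Qed.

(** Convergence is reduced to that of the real and imaginary parts, which are
absolutely convergent real series. *)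
Lemma cvg_complex_series u (M : C) :
  (forall n, \sum_(k < n) `|u k| <= M) -> cvgn (series u).
Proof.
move=> uM.
have M_real : M = (complex.Re M)%:C.
  rewrite -[LHS](@RRe_real R) // realE.
  by rewrite (le_trans _ (uM 0%N)) // big_ord0.
have part_cvg (part : C -> R) : (forall w, (`|part w|)%:C <= `|w|) ->
    cvgn (series (fun n => part (u n))).
  move=> part_le; apply: (@cvg_real_series _ (complex.Re M)) => n.
  rewrite -lecR -M_real (le_trans _ (uM n)) // rmorph_sum /=.
  by apply: ler_sum => k _.
have re_cvg : cvgn (series (fun n => complex.Re (u n))).
  by apply: part_cvg => w; exact: normc_ge_Re.
have im_cvg : cvgn (series (fun n => complex.Im (u n))).
  apply: part_cvg => w; rewrite -normrN -(ReiNIm w).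
  rewrite (le_trans (normc_ge_Re _)) // normrM.
  by rewrite [X in _ * X]normc_def /= expr0n expr1n add0r sqrtr1 mulr1.
have -> : series u = (fun n => (series (fun n => complex.Re (u n)) n)%:C +
    (series (fun n => complex.Im (u n)) n)%:C * ('i%C : C)).
  apply/funext => n; rewrite /series /= !rmorph_sum /= mulr_suml -big_split /=.
  by apply: eq_bigr => k _; rewrite [LHS](complexE (u k)) mulrC.
apply: is_cvgD.
  by apply: (cvgP (_ : C)); exact: cvg_real_complex re_cvg.
by apply: is_cvgMr_tmp; apply: (cvgP (_ : C)); exact: cvg_real_complex im_cvg.
Qed.

Lemma limn_norm_le u (l M : C) :
  u @ \oo --> l -> (forall n, `|u n| <= M) -> `|l| <= M.
Proof.
move=> ul uM; apply/ler_addgt0Pr => e e0.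
near \oo => n; rewrite -[l](subrK (u n)) (le_trans (ler_normD _ _)) // addrC.
rewrite lerD //; near: n.
by move/cvgrPdist_le : ul; apply.
Unshelve. all: by end_near.
Qed.

End ComplexSeries.

(** * Power series in the open unit disc *)

Lemma sum_expr_le (K : numFieldType) (q : K) n : 0 <= q -> q < 1 ->
  \sum_(k < n) q ^+ k <= (1 - q)^-1.
Proof.
move=> q0 q1; rewrite -[(1 - q)^-1]mulr1 ler_pdivlMl ?subr_gt0 //.
have -> : (1 - q) * (\sum_(k < n) q ^+ k) = 1 - q ^+ n.
  by rewrite -[RHS]opprB subrX1 -mulNr opprB.
by rewrite lerBlDr lerDl exprn_ge0.
Qed.

(** Each of the [n] copies of [q ^+ n] is at most one of the terms
[q ^+ 0], ..., [q ^+ n.-1] of the geometric sum. *)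
Lemma natr_mul_expr_le (K : numFieldType) (q : K) n : 0 <= q -> q < 1 ->
  n%:R * q ^+ n <= (1 - q)^-1.
Proof.
move=> q0 q1; apply: le_trans (sum_expr_le n q0 q1).
rewrite mulr_natl -[n in _ *+ n]card_ord -sumr_const.
by apply: ler_sum => k _; rewrite ler_wiXn2l // ?ltW // ltnW.
Qed.

(** The factor [r ^+ 2] on the left avoids the exponent [n - 2] of the usual
bound. With D_n for the expression inside the norm, the induction rests on
D_(n+1) = w D_n + n (w - z)^2 z^(n-1). *)
Lemma expr_taylor1_le (K : numFieldType) (z w r : K) n :
  `|z| <= r -> `|w| <= r ->
  r ^+ 2 * `|w ^+ n - z ^+ n - n%:R * (w - z) * z ^+ n.-1|
    <= n%:R ^+ 2 * `|w - z| ^+ 2 * r ^+ n.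
Proof.
move=> zr wr; have r0 : 0 <= r := le_trans (normr_ge0 z) zr.
elim: n => [|n IHn]; first by rewrite !mul0r !subrr normr0 mulr0 expr0n !mul0r.
set D := `|_| in IHn.
have -> : w ^+ n.+1 - z ^+ n.+1 - n.+1%:R * (w - z) * z ^+ n.+1.-1 =
  w * (w ^+ n - z ^+ n - n%:R * (w - z) * z ^+ n.-1) +
  n%:R * (w - z) ^+ 2 * z ^+ n.-1.
  by case: n {IHn D} => [|n] /=; rewrite ?exprS -?natr1; ring.
have main : r ^+ 2 * (r * D + n%:R * `|w - z| ^+ 2 * `|z| ^+ n.-1) <=
    r * (n%:R ^+ 2 * `|w - z| ^+ 2 * r ^+ n) +
    n%:R * `|w - z| ^+ 2 * r ^+ n.+1.
  rewrite mulrDr lerD //; first by rewrite mulrCA ler_wpM2l.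
  case: n {IHn D} => [|n]; first by rewrite !mul0r mulr0.
  rewrite mulrCA ler_wpM2l ?mulr_ge0 ?ler0n ?exprn_ge0 //=.
  by rewrite -[n.+2]/(2 + n)%N exprD ler_wpM2l ?exprn_ge0 // lerXn2r ?nnegrE.
apply: (le_trans (le_trans _ main)).
  rewrite ler_wpM2l ?exprn_ge0 // (le_trans (ler_normD _ _)) // lerD //.
    by rewrite normrM ler_wpM2r.
  by rewrite !normrM normr_nat !normrX.
rewrite -subr_ge0 [X in 0 <= X](_ : _ = n.+1%:R * `|w - z| ^+ 2 * r ^+ n.+1).
  by rewrite !mulr_ge0 ?exprn_ge0.
by rewrite (exprS r n) -natr1; ring.
Qed.

Lemma near_norm_lt (K : numFieldType) (z r : K) :
  `|z| < r -> \forall w \near z, `|w| < r.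
Proof. exact: (@cvgr_norm_lt _ _ _ (nbhs z) _ id z (@cvg_id _ _) _). Qed.

Lemma is_derive_of_quadratic_remainder (K : numFieldType) (F : K -> K)
    (z D B : K) : 0 <= B ->
  (\forall w \near z, `|F w - F z - (w - z) * D| <= B * `|w - z| ^+ 2) ->
  is_derive z 1 F D.
Proof.
move=> B0 /nbhs_ballP[d /= d0 FB].
suff lim_quot : h^-1 *: ((F \o shift z) (h *: 1) - F z) @[h --> 0^'] --> D.
  by apply: DeriveDef; [exact: (cvgP D)|exact: cvg_lim].
apply/cvgrPdist_le => e e0; near=> h.
have h0 : h != 0 by near: h; exact: nbhs_dnbhs_neq.
have hd : `|h| < d by near: h; exact: dnbhs0_lt.
(* [B] may vanish, hence the division by [B + 1]. *)
have he : `|h| <= e / (B + 1).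
  by near: h; apply: dnbhs0_le; rewrite divr_gt0 // ltr_wpDl.
have /FB : ball z d (h + z).
  by rewrite -ball_normE /= opprD addrCA subrr addr0 normrN.
rewrite addrK => FBh; rewrite distrC /shift /= /GRing.scale /= mulr1.
have -> : h^-1 * (F (h + z) - F z) - D = h^-1 * (F (h + z) - F z - h * D).
  by rewrite [RHS]mulrBr mulKf.
rewrite normrM normfV ler_pdivrMl ?normr_gt0 //.
rewrite (le_trans FBh) // expr2 mulrCA ler_wpM2l //.
rewrite (le_trans (ler_wpM2l B0 he)) // mulrA ler_pdivrMr ?ltr_wpDl //.
by rewrite mulrC ler_wpM2l ?ltW // ltrDl.
Unshelve. all: by end_near.
Qed.

Section PowerSeries.
Variable R : realType.
Local Notation C := (CC R).
Implicit Types (c d : C^nat) (z w r k : C).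

Definition psum c z : C := limn (series (fun n => c n * z ^+ n)).

(** Radius of convergence at least 1, in the form of Abel's lemma: this form is
visibly stable under linear combinations and is what a ratio test gives. *)
Definition disc_bounded c : Prop :=
  forall r, 0 < r -> r < 1 -> exists M : C, forall n, `|c n| * r ^+ n <= M.

(** The Euler operator z d/dz on coefficient sequences; working with it instead
of d/dz avoids all index shifts until the differential equation. *)
Definition theta_coef c : C^nat := fun n => n%:R * c n.

Lemma disc_boundedD c d : disc_bounded c -> disc_bounded d ->
  disc_bounded (fun n => c n + d n).
Proof.
move=> cr dr r r0 r1; have [[M cM] [N dN]] := (cr r r0 r1, dr r r0 r1).
exists (M + N) => n; rewrite (le_trans _ (lerD (cM n) (dN n))) // -mulrDl.
by rewrite ler_wpM2r ?ler_normD // exprn_ge0 ?ltW.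
Qed.

Lemma disc_boundedZ k c : disc_bounded c -> disc_bounded (fun n => k * c n).
Proof.
move=> cr r r0 r1; have [M cM] := cr r r0 r1.
by exists (`|k| * M) => n; rewrite normrM -mulrA ler_wpM2l.
Qed.

(** The factor [n] is absorbed by comparing with a radius [s] strictly between
[r] and 1. *)
Lemma disc_bounded_theta c : disc_bounded c -> disc_bounded (theta_coef c).
Proof.
move=> cr r r0 r1; have [r_lt lt_1] := midf_lt r1; set s := _ / 2 in r_lt lt_1.
have s0 : 0 < s := lt_trans r0 r_lt.
have [M cM] := cr s s0 lt_1.
have q0 : 0 <= r / s by rewrite divr_ge0 ?ltW.
have q1 : r / s < 1 by rewrite ltr_pdivrMr // mul1r.
exists ((1 - r / s)^-1 * M) => n; rewrite normrM normr_nat.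
have -> : n%:R * `|c n| * r ^+ n = (n%:R * (r / s) ^+ n) * (`|c n| * s ^+ n).
  by rewrite expr_div_n; field; rewrite expf_neq0 ?gt_eqF.
apply: ler_pM => //; last exact: natr_mul_expr_le.
  by rewrite mulr_ge0 ?exprn_ge0.
by rewrite mulr_ge0 ?exprn_ge0 ?(ltW s0).
Qed.

Lemma disc_bounded_majorant c r : disc_bounded c -> 0 < r -> r < 1 ->
  exists M : C, forall n, \sum_(k < n) `|c k| * r ^+ k <= M.
Proof.
move=> cr r0 r1; have [r_lt lt_1] := midf_lt r1; set s := _ / 2 in r_lt lt_1.
have s0 : 0 < s := lt_trans r0 r_lt.
have [M cM] := cr s s0 lt_1.
have q0 : 0 <= r / s by rewrite divr_ge0 ?ltW.
have q1 : r / s < 1 by rewrite ltr_pdivrMr // mul1r.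
have M0 : 0 <= M by rewrite (le_trans _ (cM 0%N)) // mulr_ge0 ?expr0.
exists (M * (1 - r / s)^-1) => n.
apply: le_trans (ler_wpM2l M0 (sum_expr_le n q0 q1)); rewrite mulr_sumr.
apply: ler_sum => k _; rewrite expr_div_n mulrCA mulrC.
rewrite ler_wpM2l ?exprn_ge0 ?(ltW r0) // ler_pdivlMr ?exprn_gt0 //.
Qed.

Lemma norm_lt1_radius z : `|z| < 1 -> exists2 r, `|z| < r & 0 < r /\ r < 1.
Proof.
move=> z1; have [lt_r r_1] := midf_lt z1.
by exists ((`|z| + 1) / 2) => //; split=> //; exact: le_lt_trans lt_r.
Qed.

Lemma cvg_psum c z : disc_bounded c -> `|z| < 1 ->
  series (fun n => c n * z ^+ n) @ \oo --> psum c z.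
Proof.
move=> cr /norm_lt1_radius[r zr [r0 r1]].
have [M cM] := disc_bounded_majorant cr r0 r1.
apply: (@cvg_complex_series R _ M) => n; apply: le_trans (cM n).
apply: ler_sum => k _; rewrite normrM normrX ler_wpM2l //.
by rewrite lerXn2r ?nnegrE ?(ltW r0) // ltW.
Qed.

Lemma cvg_eq (u v : C^nat) (l : C) : u =1 v -> u @ \oo --> l -> v @ \oo --> l.
Proof. by move=> /funext ->. Qed.

Lemma psumE c z (l : C) :
  series (fun n => c n * z ^+ n) @ \oo --> l -> psum c z = l.
Proof. exact: cvg_lim. Qed.

Lemma psumD c d z : disc_bounded c -> disc_bounded d -> `|z| < 1 ->
  psum (fun n => c n + d n) z = psum c z + psum d z.
Proof.
move=> cr dr z1; apply: psumE.
apply: (cvg_eq _ (cvgD (cvg_psum cr z1) (cvg_psum dr z1))) => n /=.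
rewrite fctE /series /= -big_split /=.
by apply: eq_bigr => k _; rewrite mulrDl.
Qed.

Lemma psumZ k c z : disc_bounded c -> `|z| < 1 ->
  psum (fun n => k * c n) z = k * psum c z.
Proof.
move=> cr z1; apply: psumE.
apply: (cvg_eq _ (cvgMl_tmp (a := k) (cvg_psum cr z1))) => n /=.
rewrite /series /= mulr_sumr /=.
by apply: eq_bigr => i _; rewrite mulrA.
Qed.

Lemma psum_shift c z : disc_bounded (fun n => c n.+1) -> `|z| < 1 ->
  psum c z = c 0%N + z * psum (fun n => c n.+1) z.
Proof.
move=> cr z1; apply: psumE; rewrite -cvg_shiftS.
apply: (cvg_eq _ (cvgD (cvg_cst (c 0%N))
  (cvgMl_tmp (a := z) (cvg_psum cr z1)))) => n /=.
rewrite fctE /series /= big_nat_recl //=.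
rewrite expr0 mulr1 mulr_sumr; congr (_ + _).
by apply: eq_bigr => i _; rewrite exprS mulrCA.
Qed.

(** Summing the first order Taylor estimates of the monomials over all terms
bounds the remainder of the sum by a constant times |w - z|^2, the constant
being finite because n^2 c_n still has radius of convergence at least 1. The
derivative is given through [z * D], the form in which the Euler operator
uses it. *)
Lemma is_derive_psum c z : disc_bounded c -> `|z| < 1 ->
  exists2 D, is_derive z 1 (psum c) D & z * D = psum (theta_coef c) z.
Proof.
move=> cr z1; have [r zr [r0 r1]] := norm_lt1_radius z1.
have tr := disc_bounded_theta cr.
have [M tM] := disc_bounded_majorant tr r0 r1.
have [N ttN] := disc_bounded_majorant (disc_bounded_theta tr) r0 r1.
(* At [n = 0] the exponent is 0 and not -1; the factor [n%:R] kills the term. *)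
pose dterm n := theta_coef c n * z ^+ n.-1.
have dcvg : cvgn (series dterm).
  apply: (@cvg_complex_series R _ (r^-1 * M)) => n.
  apply: (le_trans _ (ler_wpM2l _ (tM n))); last by rewrite invr_ge0 ltW.
  rewrite mulr_sumr; apply: ler_sum => -[[|k] ltk] _ /=.
    by rewrite /dterm /theta_coef /= !mul0r normr0 mul0r mulr0.
  rewrite /dterm normrM normrX /= exprS mulrCA mulKf ?gt_eqF //.
  by rewrite ler_wpM2l // lerXn2r ?nnegrE ?(ltW r0) // ltW.
pose D := limn (series dterm); exists D; last first.
  apply/esym/psumE; apply: (cvg_eq _ (cvgMl_tmp (a := z) dcvg)) => n /=.
  rewrite /series /= mulr_sumr /=.
  apply: eq_bigr => -[|i] _; rewrite /dterm /= mulrCA; last by rewrite -exprS.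
  by rewrite /theta_coef !mul0r.
have N0 : 0 <= N by have := ttN 0%N; rewrite big_ord0.
apply: (@is_derive_of_quadratic_remainder _ _ _ _ (N / r ^+ 2)).
  by rewrite divr_ge0 ?exprn_ge0 ?(ltW r0).
near=> w.
have wr : `|w| <= r by apply: ltW; near: w; exact: near_norm_lt.
have w1 := le_lt_trans wr r1.
pose rem n := c n * w ^+ n - c n * z ^+ n - (w - z) * dterm n.
have rem_cvg : series rem @ \oo --> psum c w - psum c z - (w - z) * D.
  apply: (cvg_eq _ (cvgB (cvgB (cvg_psum cr w1) (cvg_psum cr z1))
    (cvgMl_tmp (a := w - z) dcvg))) => n; rewrite !fctE /series /= mulr_sumr.
  by rewrite -!sumrB.
have rem_le n : `|rem n| <= `|w - z| ^+ 2 / r ^+ 2 *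
    (`|theta_coef (theta_coef c) n| * r ^+ n).
  rewrite /rem /dterm /theta_coef.
  have -> : c n * w ^+ n - c n * z ^+ n - (w - z) * (n%:R * c n * z ^+ n.-1) =
    c n * (w ^+ n - z ^+ n - n%:R * (w - z) * z ^+ n.-1) by ring.
  have := ler_wpM2l (normr_ge0 (c n)) (expr_taylor1_le n (ltW zr) wr).
  rewrite mulrCA -ler_pdivlMl ?exprn_gt0 // normrM => /le_trans; apply.
  by rewrite !normrM !normr_nat le_eqVlt; apply/orP; left; apply/eqP; ring.
apply: (limn_norm_le rem_cvg) => n; rewrite /series /=.
rewrite (le_trans (ler_norm_sum _ _ _)) // big_mkord.
rewrite [X in _ <= X](_ : _ = `|w - z| ^+ 2 / r ^+ 2 * N); last by ring.
apply: le_trans (ler_wpM2l _ (ttN n)).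
  by rewrite mulr_sumr; apply: ler_sum => k _; exact: rem_le.
by rewrite divr_ge0 ?exprn_ge0 ?(ltW r0).
Unshelve. all: by end_near.
Qed.

End PowerSeries.

(** * The Gauss series and its differential equation *)

(** The difference of the two sides is quadratic in [n] with leading coefficient
[1 - r > 0]. *)
Lemma gauss_ratio_real (R : realType) (x y w r : R) :
  0 <= x -> 0 <= y -> 0 <= w -> 0 < r -> r < 1 ->
  exists N, forall n, (N <= n)%N ->
    (x + n%:R) * (y + n%:R) * r <= (n%:R - w) * n.+1%:R.
Proof.
move=> x0 y0 w0 r0 r1.
(* At [t = n%:R], [t ^+ 2 * (1 - r)] has to dominate the lower order terms; once
   [t * (1 - r) >= K] and [t >= 1], each monomial of [K] pays for one of them. *)
pose K := 2 * w + x + y + x * y.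
have K0 : 0 <= K / (1 - r).
  by rewrite divr_ge0 ?subr_ge0 ?(ltW r1) // !addr_ge0 ?mulr_ge0.
exists (Num.bound (K / (1 - r))).+1 => n Nn.
have Kn : K <= n%:R * (1 - r).
  rewrite -ler_pdivrMr ?subr_gt0 // (le_trans (ltW (archi_boundP K0))) //.
  by rewrite ler_nat ltnW.
have n1 : 1 <= n%:R :> R by rewrite ler1n (leq_trans _ Nn).
rewrite -natr1; move: (n%:R : R) n1 Kn => t t1 Kt.
have t0 : 0 <= t := le_trans ler01 t1.
have t_ge0 : 0 <= t * (t * (1 - r) - K) by apply: mulr_ge0; rewrite ?subr_ge0.
have w_ge0 : 0 <= w * (t - 1) by apply: mulr_ge0; rewrite ?subr_ge0.
have xy_ge0 : 0 <= (x + y) * (t * (1 - r)).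
  by apply: mulr_ge0; [exact: addr_ge0|apply: mulr_ge0; lra].
have xyt_ge0 : 0 <= x * y * (t - r).
  by apply: mulr_ge0; [exact: mulr_ge0|lra].
by rewrite /K in t_ge0; lra.
Qed.

Section Gauss.
Variable R : realType.
Local Notation C := (CC R).
Local Notation "x %:C" := (real_complex R x : C).
Implicit Types (u : C^nat) (a b c z r : C).

Lemma ge0_complexE z : 0 <= z -> exists2 x : R, 0 <= x & z = x%:C.
Proof.
move=> z0; have zE : z = (complex.Re z)%:C.
  by rewrite -[LHS](@RRe_real R) // realE z0.
by exists (complex.Re z) => //; rewrite -ler0c -zE.
Qed.

Lemma gauss_ratio a b c r : 0 < r -> r < 1 -> exists N, forall n, (N <= n)%N ->
  `|a + n%:R| * `|b + n%:R| * r <= `|c + n%:R| * n.+1%:R.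
Proof.
move=> r0 r1.
have [x x0 xE] := ge0_complexE (normr_ge0 a).
have [y y0 yE] := ge0_complexE (normr_ge0 b).
have [w w0 wE] := ge0_complexE (normr_ge0 c).
have [s _ sE] := ge0_complexE (ltW r0).
have [s0 s1] : 0 < s /\ s < 1 by rewrite -!ltcR -sE.
have [N HN] := gauss_ratio_real x0 y0 w0 s0 s1.
exists N => n /HN le_n.
apply: (@le_trans _ _ ((x%:C + n%:R) * (y%:C + n%:R) * s%:C)).
  rewrite sE ler_pM2r ?ltcR // -xE -yE -[n%:R in leRHS]normr_nat.
  by rewrite ler_pM // ler_normD.
apply: (@le_trans _ _ ((n%:R - w%:C) * n.+1%:R)).
  rewrite -!(rmorph_nat (real_complex R)) -!(rmorphD (real_complex R)).
  by rewrite -!(rmorphB (real_complex R)) -!(rmorphM (real_complex R)) lecR.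
rewrite ler_wpM2r // -wE -[X in X - _]normr_nat lerBlDr.
by rewrite (le_trans _ (ler_normB _ _)) // [c + _]addrC addrK.
Qed.

Lemma disc_bounded_ratio u :
  (forall r, 0 < r -> r < 1 ->
     exists N, forall n, (N <= n)%N -> `|u n.+1| * r <= `|u n|) ->
  disc_bounded u.
Proof.
move=> u_ratio r r0 r1; have [N uN] := u_ratio r r0 r1.
exists (\sum_(k < N.+1) `|u k| * r ^+ k) => n.
have ge0 k : 0 <= `|u k| * r ^+ k by rewrite mulr_ge0 ?exprn_ge0 ?(ltW r0).
have small k : (k <= N)%N ->
    `|u k| * r ^+ k <= \sum_(k < N.+1) `|u k| * r ^+ k.
  move=> kN; rewrite (bigD1 (Ordinal (kN : (k < N.+1)%N))) //= lerDl.
  exact: sumr_ge0.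
elim: n => [|n IHn]; first exact: small.
have [nN|Nn] := ltnP n N; first exact: small.
apply: le_trans IHn; rewrite exprS mulrA ler_wpM2r ?uN //.
by rewrite exprn_ge0 ?ltW.
Qed.

Definition gauss_coef a b c : C^nat := fun n =>
  poch a n * poch b n / (poch c n * (n`!)%:R).

Lemma pochS a n : poch a n.+1 = poch a n * (a + n%:R).
Proof. exact: big_ord_recr. Qed.

Section Params.
Variables a b c : C.
Hypothesis c_gen : forall n : nat, c != - n%:R.
Local Notation A := (gauss_coef a b c).

Lemma addn_neq0 n : c + n%:R != 0.
Proof. by rewrite addr_eq0. Qed.

Lemma poch_neq0 n : poch c n != 0.
Proof. by apply/prodf_neq0 => k _; exact: addn_neq0. Qed.

(** The two-term recurrence of the Gauss coefficients; it encodes the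
hypergeometric equation. *)
Lemma gauss_coefS n :
  n.+1%:R * (c + n%:R) * A n.+1 = (a + n%:R) * (b + n%:R) * A n.
Proof.
rewrite /gauss_coef !pochS factS natrM.
have := poch_neq0 n; have := addn_neq0 n.
have : n.+1%:R != 0 :> C by rewrite pnatr_eq0.
have : (n`!)%:R != 0 :> C by rewrite pnatr_eq0 -lt0n fact_gt0.
by move=> *; field; do !(apply/andP; split).
Qed.

Lemma disc_bounded_gauss : disc_bounded A.
Proof.
apply: disc_bounded_ratio => r r0 r1; have [N HN] := gauss_ratio a b c r0 r1.
exists N => n /HN le_n.
have cn0 : 0 < `|c + n%:R| * n.+1%:R.
  by rewrite mulr_gt0 ?normr_gt0 ?addn_neq0 ?ltr0Sn.
rewrite -(ler_pM2l cn0).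
have -> : `|c + n%:R| * n.+1%:R * (`|A n.+1| * r) =
    `|a + n%:R| * `|b + n%:R| * r * `|A n|.
  have := congr1 Num.norm (gauss_coefS n); rewrite !normrM normr_nat => e.
  by rewrite mulrA [`|c + _| * _]mulrC e mulrAC.
exact: ler_wpM2r.
Qed.

(** The equation theta (theta + c - 1) f = z (theta + a) (theta + b) f, solved
for the second order term. Both sides are power series, and their
coefficients agree by the recurrence. *)
Lemma gauss_ode z : `|z| < 1 ->
  (1 - z) * psum (theta_coef (theta_coef A)) z =
  ((a + b) * z - c + 1) * psum (theta_coef A) z + a * b * z * psum A z.
Proof.
move=> z1; have dA := disc_bounded_gauss.
have dTA := disc_bounded_theta dA; have dTTA := disc_bounded_theta dTA.
(* The coefficients of theta (theta + c - 1) f. The one of degree 0 vanishes, and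
   shifting the others by one degree gives (theta + a) (theta + b) f. *)
pose e n := theta_coef (theta_coef A) n + (c - 1) * theta_coef A n.
have e0 : e 0%N = 0 by rewrite /e /theta_coef !mul0r mulr0 addr0.
have eS : (fun n => e n.+1) = (fun n => theta_coef (theta_coef A) n +
    ((a + b) * theta_coef A n + a * b * A n)).
  apply/funext => n; rewrite /e /theta_coef.
  transitivity (n.+1%:R * (c + n%:R) * A n.+1); first by rewrite -natr1; ring.
  by rewrite gauss_coefS; ring.
have dE : disc_bounded (fun n => (a + b) * theta_coef A n + a * b * A n).
  by apply: disc_boundedD; exact: disc_boundedZ.
have := psum_shift (c := e) _ z1; rewrite eS => /(_ (disc_boundedD dTTA dE)).
rewrite (psumD dTTA (disc_boundedZ _ dTA) z1) (psumZ _ dTA z1) e0 add0r.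
rewrite (psumD dTTA dE z1).
rewrite (psumD (disc_boundedZ _ dTA) (disc_boundedZ _ dA) z1) !psumZ //.
set F := psum A z; set Q := psum _ z; set P := psum _ z => eq.
have -> : (1 - z) * Q = Q + (c - 1) * P - (z * Q + (c - 1) * P) by ring.
by rewrite eq; ring.
Qed.

End Params.

End Gauss.

(** * The change of basis as an identity of functions *)

Section Bases.
Variable R : realType.
Local Notation C := (CC R).
Variables a b c : C.
Hypothesis c_gen : forall n : nat, c != - n%:R.
Local Notation A := (gauss_coef a b c).
Implicit Types z : C.

Lemma theta_psum u z : disc_bounded u -> `|z| < 1 ->
  z * derive1 (psum u) z = psum (theta_coef u) z.
Proof.
move=> du z1; have [D uD <-] := is_derive_psum du z1.
by rewrite derive1E derive_val.
Qed.

Lemma theta_hypfE z : `|z| < 1 ->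
  theta (@hypf R) a b c z = psum (theta_coef A) z.
Proof. by move=> z1; exact: theta_psum (disc_bounded_gauss a b c_gen) z1. Qed.

Lemma theta_hypgE z : `|z| < 1 ->
  theta (@hypg R) a b c z = 2 * (psum A z * psum (theta_coef A) z).
Proof.
move=> z1; have [D AD zD] := is_derive_psum (disc_bounded_gauss a b c_gen) z1.
rewrite /theta (_ : hypg a b c = psum A * psum A); last first.
  by apply/funext => w; exact: expr2.
rewrite derive1E (derive_val (is_derive := is_deriveM AD AD)) -zD.
by rewrite /GRing.scale /=; ring.
Qed.

(** Only the values of [theta g] near [z] matter for its derivative, and there it
is the product of two power series. *)
Lemma theta2_hypgE z : `|z| < 1 ->
  theta (theta (@hypg R)) a b c z =
  2 * (psum (theta_coef A) z ^+ 2 +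
       psum A z * psum (theta_coef (theta_coef A)) z).
Proof.
move=> z1; have dA := disc_bounded_gauss a b c_gen.
have [D AD zD] := is_derive_psum dA z1.
have [E TE zE] := is_derive_psum (disc_bounded_theta dA) z1.
rewrite [LHS]/theta derive1E.
rewrite (@near_eq_derive _ _ _ _ (2 \*: (psum A * psum (theta_coef A))));
  last first.
  by near=> w; apply: theta_hypgE; near: w; exact: near_norm_lt.
rewrite (derive_val (is_derive := is_deriveZ 2 (is_deriveM AD TE))) -zE -zD.
by rewrite /GRing.scale /=; ring.
Unshelve. all: by end_near.
Qed.

Lemma Bsym_Phi z : `|z| < 1 -> Bsym a b c z *m Phi a b c z = Bg a b c z.
Proof.
move=> z1; have ode := gauss_ode a b c_gen z1.
have z1' : 1 - z != 0.
  by rewrite subr_eq0; apply: contraTneq z1 => <-; rewrite normr1 ltxx.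
apply/rowP => j; rewrite !mxE !big_ord_recr big_ord0 /= !mxE /= add0r.
rewrite (theta_hypfE z1) theta_hypgE // theta2_hypgE //.
rewrite -[hypf a b c z]/(psum A z) -[hypg a b c z]/(psum A z ^+ 2).
set F := psum A z in ode *; set Q := psum _ z in ode *.
set P := psum _ z in ode *.
have QE : Q = (((a + b) * z - c + 1) * P + a * b * z * F) / (1 - z).
  by rewrite -ode mulrC mulKf.
case: j => [[|[|[|j]]] ltj] //=.
- by ring.
- by ring.
- by rewrite QE; field.
Qed.

End Bases.

(** * Generic evaluation of rational functions *)

Section RationalFunctions.
Variable R : realType.
Implicit Types (r s : ratf R) (p q : mpoly 4 (CC R)).

Lemma denom_neq0 r : denom r != 0.
Proof. exact: denom_ratioP. Qed.

Lemma numer_denomE r : tofrac (numer r) / tofrac (denom r) = r.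
Proof.
apply: (@mulIf _ (tofrac (denom r))); first by rewrite tofrac_eq0 denom_neq0.
rewrite divfK ?tofrac_eq0 ?denom_neq0 //.
rewrite -[r in r * _]reprK.
rewrite /numer /denom; unlock tofrac; rewrite -[RHS]FracField.pi_mul.
apply/eqmodP; rewrite /= FracField.equivfE /FracField.mulf.
by rewrite !numden_Ratio ?mulr1 ?oner_neq0 ?denom_ratioP // mul1r mulrC.
Qed.

Definition param : Type := (CC R * CC R * CC R * CC R)%type.

Definition at_param (T : Type) (h : pfun R T) (p : param) : T :=
  h p.1.1.1 p.1.1.2 p.1.2 p.2.

(** The sets that contain, up to the exclusions made by [generic_eq], the
complement of the zero set of a nonzero polynomial. They form a filter because
the polynomial ring is an integral domain, so that [generic_eq] is equality
eventually along this filter. *)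
Definition generic : set_system param := [set Q |
  exists2 q : mpoly 4 (CC R), q != 0 &
    forall a b c z : CC R,
      `|z| < 1 -> (forall k : int, c != k%:~R) ->
      meval (Defs.point a b c z) q != 0 -> Q (a, b, c, z)].

Global Instance generic_is_filter : Filter generic.
Proof.
split.
- by exists 1; rewrite ?oner_neq0.
- move=> P Q [p p0 Pp] [q q0 Qq]; exists (p * q); first by rewrite mulf_neq0.
  move=> a b c z z1 cZ; rewrite mevalM mulf_eq0 negb_or => /andP[pz qz].
  by split; [exact: Pp|exact: Qq].
- by move=> P Q PQ [p p0 Pp]; exists p => // a b c z z1 cZ pz; exact/PQ/Pp.
Qed.

Lemma generic_dom : \forall x \near generic,
  `|x.2| < 1 /\ forall k : int, x.1.2 != k%:~R.
Proof. by exists 1; rewrite ?oner_neq0. Qed.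

Definition param_point (x : param) := at_param (@Defs.point R) x.

(** The evaluation is only well behaved along [generic]: it depends on the chosen
fraction where its denominator vanishes. *)
Definition ev r (x : param) := at_param (rateval r) x.

(** The value does not depend on the fraction that represents the rational
function. Every other property of [ev] follows from this one by exhibiting
a suitable fraction. *)
Lemma ev_frac p q : q != 0 ->
  \forall x \near generic, ev (tofrac p / tofrac q) x =
    meval (param_point x) p / meval (param_point x) q.
Proof.
move=> q0; set r := _ / _; exists (q * denom r).
  by rewrite mulf_neq0 ?denom_neq0.
have e : numer r * q = p * denom r.
  have /eqP : tofrac (numer r) / tofrac (denom r) = tofrac p / tofrac q.
    exact: numer_denomE.
  rewrite eqr_div ?tofrac_eq0 ?denom_neq0 // -!tofracM tofrac_eq.
  by move/eqP.
move=> a b c z _ _; rewrite mevalM mulf_eq0 negb_or => /andP[q1 d1].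
apply/eqP; rewrite eqr_div //; apply/eqP.
by rewrite -!mevalM e.
Qed.

Lemma ev_denom r :
  \forall x \near generic, meval (param_point x) (denom r) != 0.
Proof. by exists (denom r); rewrite ?denom_neq0. Qed.

Lemma evE r x :
  ev r x = meval (param_point x) (numer r) / meval (param_point x) (denom r).
Proof. by []. Qed.

Lemma ev_add r s : \forall x \near generic, ev (r + s) x = ev r x + ev s x.
Proof.
have -> : r + s = tofrac (numer r * denom s + numer s * denom r) /
   tofrac (denom r * denom s).
  rewrite tofracD !tofracM -addf_div ?tofrac_eq0 ?denom_neq0 //.
  by rewrite !numer_denomE.
move: (ev_frac (numer r * denom s + numer s * denom r)
  (mulf_neq0 (denom_neq0 r) (denom_neq0 s))) (ev_denom r) (ev_denom s).
apply: filterS3 => x -> dr ds.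
by rewrite (evE r) (evE s) (addf_div _ _ dr ds) -!mevalM -mevalD.
Qed.

Lemma ev_mul r s : \forall x \near generic, ev (r * s) x = ev r x * ev s x.
Proof.
have -> : r * s = tofrac (numer r * numer s) / tofrac (denom r * denom s).
  by rewrite !tofracM -mulf_div !numer_denomE.
near=> x; rewrite (evE r) (evE s) mulf_div -!mevalM; near: x.
exact: ev_frac (mulf_neq0 (denom_neq0 r) (denom_neq0 s)).
Unshelve. all: by end_near.
Qed.

Lemma ev_poly p :
  \forall x \near generic, ev (tofrac p) x = meval (param_point x) p.
Proof.
near=> x; rewrite -[tofrac p]divr1 -[meval _ p]divr1.
rewrite -tofrac1 -(meval1 (param_point x)).
by near: x; exact: ev_frac (oner_neq0 _).
Unshelve. all: by end_near.
Qed.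

Lemma ev_opp r : \forall x \near generic, ev (- r) x = - ev r x.
Proof.
have -> : - r = tofrac (- numer r) / tofrac (denom r).
  by rewrite tofracN mulNr numer_denomE.
move: (ev_frac (- numer r) (denom_neq0 r)).
by apply: filterS => x ->; rewrite evE mevalN mulNr.
Qed.

Lemma ev_nat n : \forall x \near generic, ev n%:R x = n%:R.
Proof.
move: (ev_poly (n%:R : mpoly 4 (CC R))).
by apply: filterS => x; rewrite !rmorph_nat.
Qed.

Lemma ev_sqr r : \forall x \near generic, ev (r ^+ 2) x = ev r x ^+ 2.
Proof. exact: ev_mul. Qed.

Lemma ev_muln r s n :
  \forall x \near generic, ev (n%:R * r * s) x = n%:R * ev r x * ev s x.
Proof.
move: (ev_mul (n%:R * r) s) (ev_mul n%:R r) (ev_nat n).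
by apply: filterS3 => x -> -> ->.
Qed.

Lemma ev_sum (I : Type) (l : seq I) (F : I -> ratf R) :
  \forall x \near generic, ev (\sum_(i <- l) F i) x = \sum_(i <- l) ev (F i) x.
Proof.
elim: l => [|i l IHl]; near=> x.
  rewrite !big_nil -tofrac0 -[RHS](meval0 (param_point x)); near: x.
  exact: ev_poly.
rewrite !big_cons -(near IHl x) //; near: x; exact: ev_add.
Unshelve. all: by end_near.
Qed.

Definition evmx m n (A : 'M[ratf R]_(m, n)) (x : param) : 'M[CC R]_(m, n) :=
  map_mx (ev^~ x) A.

Lemma near_mx (T K : Type) (F : set_system T) {FF : Filter F} m n
    (A B : T -> 'M[K]_(m, n)) :
  (forall i j, \forall x \near F, A x i j = B x i j) ->
  \forall x \near F, A x = B x.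
Proof.
move=> AB; have : \forall x \near F, forall i j, A x i j = B x i j.
  by apply: filter_forall => i; apply: filter_forall => j; exact: AB.
by apply: filterS => x ABx; apply/matrixP => i j; exact: ABx.
Qed.

Lemma evmx_mul m n k (A : 'M[ratf R]_(m, n)) (B : 'M[ratf R]_(n, k)) :
  \forall x \near generic, evmx (A *m B) x = evmx A x *m evmx B x.
Proof.
apply: near_mx => i j; near=> x; rewrite !mxE.
rewrite (near (ev_sum _ _) x) //; apply: eq_bigr => l _; rewrite !mxE.
suff /(_ l) :
  forall l, ev (A i l * B l j) x = ev (A i l) x * ev (B l j) x by [].
near: x; apply: filter_forall => l'; exact: ev_mul.
Unshelve. all: by end_near.
Qed.

End RationalFunctions.
Arguments generic R : clear implicits.

(** * Parameter shifts *)

Section Shift.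
Variable R : realType.
Implicit Types (u : int * int * int) (r s : ratf R) (p q : mpoly 4 (CC R)).
Implicit Types (x : param R).

Definition shiftp u x : param R :=
  (x.1.1.1 + u.1.1%:~R, x.1.1.2 + u.1.2%:~R, x.1.2 + u.2%:~R, x.2).

Lemma meval_shift u p x :
  meval (param_point x) (comp_mpoly (shift_subst R u) p) =
  meval (param_point (shiftp u x)) p.
Proof.
rewrite comp_mpoly_meval; apply: meval_eq => i.
rewrite tnth_map tnth_ord_tuple mevalD mevalXU rmorph_int.
by case: i => [[|[|[|[|n]]]] lti] //=;
  rewrite /param_point /at_param /Defs.point /= ?addr0.
Qed.

Lemma comp_mpolyK (K : comNzRingType) (n m : nat) (lp : n.-tuple (mpoly m K))
    (lq : m.-tuple (mpoly n K)) :
  (forall i, comp_mpoly lp (tnth lq i) = mpolyX K (mnm1 i)) ->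
  cancel (comp_mpoly lq) (comp_mpoly lp).
Proof.
move=> lqK; elim/mpolyind => [|c k p _ _ IHp].
  by rewrite (comp_mpoly0 lq) (comp_mpoly0 lp).
rewrite (comp_mpolyD lq) (comp_mpolyD lp) IHp (comp_mpolyZ _ _ lq).
rewrite (comp_mpolyZ _ _ lp); congr (_ *: _ + _).
rewrite (comp_mpolyX k lq) (mpolyXE_id K k).
rewrite (big_morph _ (rmorphM (comp_mpoly lp)) (comp_mpoly1 lp)).
by apply: eq_bigr => i _; rewrite (rmorphXn (comp_mpoly lp)) /= lqK.
Qed.

Lemma comp_shiftK u :
  cancel (comp_mpoly (shift_subst R u)) (comp_mpoly (shift_subst R (- u))).
Proof.
apply: comp_mpolyK => i; set s' := shift_subst R (- u).
rewrite tnth_map tnth_ord_tuple (comp_mpolyD s') (comp_mpolyXU i s') -tnth_nth.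
rewrite (rmorph_int (comp_mpoly s')) tnth_map tnth_ord_tuple -addrA -intrD.
by case: i => [[|[|[|[|n]]]] lti] //=; rewrite ?addNr !addr0.
Qed.

Lemma comp_shift_neq0 u p : p != 0 -> comp_mpoly (shift_subst R u) p != 0.
Proof.
by apply: contra_neq => p0; rewrite -[p](comp_shiftK u) p0 comp_mpoly0.
Qed.

(** Shifting a nonzero polynomial gives a nonzero polynomial, and the set of
non-integral [c] is invariant under integral shifts. *)
Lemma generic_shift u (Q : param R -> Prop) :
  (\forall x \near generic R, Q x) ->
  \forall x \near generic R, Q (shiftp u x).
Proof.
move=> [q q0 Qq]; exists (comp_mpoly (shift_subst R u) q).
  exact: comp_shift_neq0.
move=> a b c z z1 cZ q1; apply: (Qq _ _ _ _ z1).
  move=> k; apply: contra_neq (cZ (k - u.2)) => ck.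
  by rewrite rmorphB /= -ck addrK.
by rewrite -(meval_shift u q (a, b, c, z)).
Qed.

(** [ratshift] substitutes in a chosen fraction; by [ev_frac] the choice does not
affect generic values. *)
Lemma ev_shift u r :
  \forall x \near generic R, ev (ratshift u r) x = ev r (shiftp u x).
Proof.
move: (ev_frac (comp_mpoly (shift_subst R u) (numer r))
  (comp_shift_neq0 u (denom_neq0 r))).
apply: filterS => x ->; rewrite evE.
by congr (_ / _); exact: meval_shift.
Qed.

Lemma evmx_shift u m n (A : 'M[ratf R]_(m, n)) :
  \forall x \near generic R,
    evmx (map_mx (ratshift u) A) x = evmx A (shiftp u x).
Proof.
apply: (near_mx (B := evmx A \o shiftp u)) => i j.
by near do rewrite !mxE; exact: ev_shift.
Unshelve. all: by end_near.
Qed.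

End Shift.

(** * Basis change and generators *)

Lemma det_Phi (K : fieldType) (a b c z : K) : \det (Phi a b c z) = 4.
Proof.
have trig : is_trig_mx (Phi a b c z)^T.
  apply/is_trig_mxP => i j; rewrite !mxE.
  by case: i j => [[|[|[|i]]] lti] [[|[|[|j]]] ltj].
rewrite -det_tr (det_trig trig) !big_ord_recr big_ord0 /= !mxE /=.
by rewrite !mul1r -natrM.
Qed.

Definition sym2_row (K : nzRingType) (w : 'rV[K]_2) : 'rV[K]_3 :=
  \row_j [:: w 0 0 ^+ 2; w 0 0 * w 0 1; w 0 1 ^+ 2]`_j.

(** The columns of [Sym2 M] are the coefficients of the products of two entries
of (u, v) M in terms of u^2, u v, v^2. *)
Lemma sym2_row_mul (K : comNzRingType) (w : 'rV[K]_2) (M : 'M[K]_2) :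
  sym2_row (w *m M) = sym2_row w *m Sym2 M.
Proof.
apply/rowP => j; rewrite !mxE !big_ord_recr !big_ord0 /= !mxE /= !add0r.
have -> : widen_ord (leqnSn 1) ord_max = 0 :> 'I_2 by apply: val_inj.
have -> : ord_max = 1 :> 'I_2 by apply: val_inj.
by case: j => [[|[|[|j]]] ltj] //=; ring.
Qed.

Lemma mulmx_chain (K : pzRingType) (m n k : nat) (v : 'rV[K]_m) (w : 'rV[K]_n)
    (A : 'M[K]_(m, n)) (B : 'M[K]_(n, k)) (C : 'M[K]_(m, k)) :
  v *m A = w -> C = A *m B -> v *m C = w *m B.
Proof. by move=> <- ->; rewrite mulmxA. Qed.

Section Main.
Variable R : realType.
Implicit Types (u : int * int * int) (r s : ratf R) (p q : mpoly 4 (CC R)).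
Implicit Types (x : param R).

Lemma is_basis_changeE m n (B : pfun R 'rV[CC R]_m) (B' : pfun R 'rV[CC R]_n)
    (P : 'M[ratf R]_(m, n)) : is_basis_change B B' P <->
  \forall x \near generic R, at_param B x *m evmx P x = at_param B' x.
Proof. by []. Qed.

Lemma is_generatorE n (B : pfun R 'rV[CC R]_n) u (M : 'M[ratf R]_n) :
  is_generator B u M <->
  \forall x \near generic R,
    at_param B x *m evmx M x = at_param B (shiftp u x).
Proof. by []. Qed.

Lemma evmx_Sym2 (M : 'M[ratf R]_2) :
  \forall x \near generic R, evmx (Sym2 M) x = Sym2 (evmx M x).
Proof.
apply: (near_mx (B := fun x => Sym2 (evmx M x))) => i j.
case: i j => [[|[|[|i]]] lti] [[|[|[|j]]] ltj] //=; near do rewrite !mxE /=.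
- exact: ev_sqr.
- exact: ev_mul.
- exact: ev_sqr.
- exact: ev_muln.
- move: (ev_add (M 0 0 * M 1 1) (M 0 1 * M 1 0)) (ev_mul (M 0 0) (M 1 1))
    (ev_mul (M 0 1) (M 1 0)).
  by apply: filterS3 => x -> -> ->.
- exact: ev_muln.
- exact: ev_sqr.
- exact: ev_mul.
- exact: ev_sqr.
Unshelve. all: by end_near.
Qed.

Lemma evmx_Phi : \forall x \near generic R,
  evmx (ratPhi R) x = Phi x.1.1.1 x.1.1.2 x.1.2 x.2.
Proof.
pose X (i : 'I_4) := mpolyX (CC R) (mnm1 i).
apply: (near_mx (B := fun x => Phi x.1.1.1 x.1.1.2 x.1.2 x.2)) => i j.
have one_neq : 1 - X 3 != 0.
  apply/eqP => /(congr1 (meval (fun=> 0))).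
  by rewrite mevalB meval1 mevalXU subr0 meval0 => /eqP; rewrite oner_eq0.
case: i j => [[|[|[|i]]] lti] [[|[|[|j]]] ltj] //=; near do rewrite !mxE /=.
all: try exact: (ev_nat _ 0).
all: try exact: (ev_nat _ 1).
all: try exact: (ev_nat _ 2).
- move: (ev_frac (2 * X 0 * X 1 * X 3) one_neq).
  apply: filterS => x.
  rewrite !tofracM tofracB tofrac1 rmorph_nat => ->.
  by rewrite mevalB meval1 !mevalM !mevalXU rmorph_nat.
- move: (ev_frac (2 * ((X 0 + X 1) * X 3 - X 2 + 1)) one_neq).
  apply: filterS => x.
  rewrite !tofracM rmorph_nat !(tofracM, tofracB, tofracD) tofrac1 => ->.
  by rewrite !mevalM rmorph_nat !(mevalB, mevalM, mevalD) meval1 !mevalXU.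
Unshelve. all: by end_near.
Qed.

(** Independence speaks of a single relation, hence is applied to each column of
[P - Q]. *)
Lemma lin_indep_inj n m (B : pfun R 'rV[CC R]_n) (P Q : 'M[ratf R]_(n, m)) :
  lin_indep B ->
  (\forall x \near generic R,
     at_param B x *m evmx P x = at_param B x *m evmx Q x) -> P = Q.
Proof.
move=> Bfree PQ; apply/subr0_eq/matrixP => i j.
suff /matrixP/(_ i 0) : col j (P - Q) = 0 by rewrite !mxE.
apply: Bfree.
have evPQ : \forall x \near generic R, evmx (P - Q) x = evmx P x - evmx Q x.
  apply: (near_mx (B := fun x => evmx P x - evmx Q x)) => k l.
  near do rewrite !mxE.
  move: (ev_add (P k l) (- Q k l)) (ev_opp (Q k l)).
  by apply: filterS2 => x -> ->.
suff : \forall x \near generic R,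
    at_param B x *m evmx (col j (P - Q)) x = 0 by [].
move: PQ evPQ; apply: filterS2 => x PQx evPQx.
rewrite /evmx map_col -/(evmx _ x) evPQx colE mulmxA mulmxBr PQx.
by rewrite subrr mul0mx.
Unshelve. all: by end_near.
Qed.

Lemma ratPhi_unit : ratPhi R \in unitmx.
Proof.
rewrite unitmxE det_Phi unitfE -[4]/(4%:R) -tofrac1 -tofracMn tofrac_eq0.
apply/eqP => /(congr1 (meval (fun=> 0))); rewrite rmorph_nat meval0.
by apply/eqP; rewrite pnatr_eq0.
Qed.

Lemma Bsym_sym2_row x : at_param (@Bsym R) x = sym2_row (at_param (@Bf R) x).
Proof. by apply/rowP => j; rewrite !mxE. Qed.

(** A generic [c] is not an integer, so the identity of functions applies. *)
Lemma Bsym_ratPhi : \forall x \near generic R,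
  at_param (@Bsym R) x *m evmx (ratPhi R) x = at_param (@Bg R) x.
Proof.
move: evmx_Phi (@generic_dom R); apply: filterS2 => x -> [z1 cZ].
by apply: Bsym_Phi => // n; have := cZ (- n%:Z); rewrite rmorphN.
Qed.

Lemma basis_change_unique (P : 'M[ratf R]_3) : lin_indep (@Bsym R) ->
  is_basis_change (@Bsym R) (@Bg R) P <-> P = ratPhi R.
Proof.
move=> Bfree; rewrite is_basis_changeE; split=> [PB|->].
  apply: (lin_indep_inj Bfree); move: PB Bsym_ratPhi.
  by apply: filterS2 => x PBx PhiBx; rewrite PBx PhiBx.
exact: Bsym_ratPhi.
Qed.

Lemma generator_sym u (Mf : 'M[ratf R]_2) : is_generator (@Bf R) u Mf ->
  is_generator (@Bsym R) u (Sym2 Mf).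
Proof.
rewrite !is_generatorE => MfP; move: MfP (evmx_Sym2 Mf).
apply: filterS2 => x MfP ->.
by rewrite !Bsym_sym2_row -sym2_row_mul MfP.
Qed.

(** Both B_sym (Phi M_g) and B_sym (S sigma_u(Phi)) compute sigma_u(B_g) from
B_sym, in the first case exactly when M_g is a generator; independence of
B_sym turns this into an identity of matrices, and Phi is invertible. *)
Lemma generator_change u (S Mg : 'M[ratf R]_3) : lin_indep (@Bsym R) ->
  is_generator (@Bsym R) u S ->
  is_generator (@Bg R) u Mg <->
    Mg = invmx (ratPhi R) *m S *m map_mx (ratshift u) (ratPhi R).
Proof.
rewrite !is_generatorE => Bfree SP; set T := map_mx _ _.
have STP : \forall x \near generic R,
    at_param (@Bsym R) x *m evmx (S *m T) x = at_param (@Bg R) (shiftp u x).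
  have {}SP : \forall x \near generic R, at_param (@Bsym R) x *m
      evmx (S *m T) x = at_param (@Bsym R) (shiftp u x) *m evmx T x.
    move: SP (evmx_mul S T).
    by apply: filterS2 => x; exact: mulmx_chain.
  move: SP (evmx_shift u (ratPhi R)) (generic_shift u Bsym_ratPhi).
  apply: filterS3 => x e1 e2 e3.
  exact: etrans e1 (etrans (congr1 (mulmx _) e2) e3).
have gE : \forall x \near generic R, at_param (@Bsym R) x *m
    evmx (ratPhi R *m Mg) x = at_param (@Bg R) x *m evmx Mg x.
  move: Bsym_ratPhi (evmx_mul (ratPhi R) Mg).
  by apply: filterS2 => x; exact: mulmx_chain.
transitivity (ratPhi R *m Mg = S *m T); last first.
  split=> [e|->]; first by rewrite -mulmxA -e mulKmx // ratPhi_unit.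
  by rewrite -mulmxA mulKVmx // ratPhi_unit.
split=> [MgP|eM].
  apply: (lin_indep_inj Bfree); move: gE MgP STP.
  apply: filterS3 => x e1 e2 e3.
  have e4 := etrans e1 e2.
  exact: etrans e4 (esym e3).
rewrite eM in gE; move: gE STP.
by apply: filterS2 => x e1 e2; exact: etrans (esym e1) e2.
Qed.

End Main.

Theorem proposition4p6 (R : realType)
    (indep_sym : lin_indep (@Bsym R)) (indep_g : lin_indep (@Bg R)) :
  [/\ forall a b c z : CC R,
        `|z| < 1 -> (forall n : nat, c != - n%:R) ->
        Bsym a b c z *m Phi a b c z = Bg a b c z,
      forall P : 'M[ratf R]_3,
        is_basis_change (@Bsym R) (@Bg R) P <-> P = ratPhi R,
      \det (ratPhi R) = 4
    & forall (u : int * int * int) (Mf : 'M[ratf R]_2),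
        is_generator (@Bf R) u Mf ->
        forall Mg : 'M[ratf R]_3,
          is_generator (@Bg R) u Mg <->
          Mg = invmx (ratPhi R) *m Sym2 Mf
               *m map_mx (ratshift u) (ratPhi R)].
Proof.
split.
- by move=> a b c z z1 c_gen; exact: Bsym_Phi.
- by move=> P; exact: basis_change_unique.
- exact: det_Phi.
- move=> u Mf Mf_gen Mg; apply: generator_change => //; exact: generator_sym.
Qed.
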